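(* Let $X$ be a Banach space with topological dual $X'$. Then: (1) every subset of an L-Dunford-Pettis set in $X'$ is L-Dunford-Pettis; (2) every L-set in $X'$ is L-Dunford-Pettis; (3) every relatively weakly compact subset of $X'$ is L-Dunford-Pettis; (4) the absolutely closed convex hull of an L-Dunford-Pettis set in $X'$ is L-Dunford-Pettis.
   Context: A norm bounded subset $A$ of a Banach space $X$ is called Dunford-Pettis (DP) if every weakly null sequence $(f_n)$ in $X'$ satisfies $\lim_{n\to\infty}\sup_{x\in A}|f_n(x)|=0$. A sequence $(x_n)$ ''is a DP set'' if the set $\{x_n : n\in\mathbb{N}\}$ is a DP set. A norm bounded subset $A$ of $X'$ is called an L-set if every weakly null sequence $(x_n)$ in $X$ satisfies $\lim_{n\to\infty}\sup_{f\in A}|f(x_n)|=0$. A norm bounded subset $A$ of $X'$ is called an L-Dunford-Pettis set if every weakly null sequence $(x_n)$ in $X$ which is a DP set in $X$ satisfies $\lim_{n\to\infty}\sup_{f\in A}|f(x_n)|=0$. The absolutely closed convex hull of a set $A$ is the closure of $\left\{\sum_{i=1}^{n}\lambda_i x_i : n\in\mathbb{N},\ x_i\in A \text{ for all } i,\ \sum_{i=1}^{n}|\lambda_i|\le 1\right\}$. *)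

(* Defs.v *)
From HB Require Import structures.
From mathcomp Require Import all_boot all_order all_algebra.
From mathcomp Require Import all_classical all_reals all_analysis.

Set Implicit Arguments.
Unset Strict Implicit.
Unset Printing Implicit Defensive.

Import Order.TTheory GRing.Theory Num.Def Num.Theory.
Import numFieldNormedType.Exports.

Local Open Scope classical_set_scope.
Local Open Scope ring_scope.

Definition dual_pred (R : realType) (X : normedModType R) : {pred X -> R^o} :=
  [pred f : X -> R^o | `[< linear f /\ continuous f >]].
Arguments dual_pred {R} X.

Lemma dual_predP (R : realType) (X : normedModType R) (f : X -> R^o) :
  reflect (linear f /\ continuous f) (f \in dual_pred X).
Proof. by rewrite inE; exact: asboolP. Qed.

Lemma dual_submod_closed (R : realType) (X : normedModType R) :
  submod_closed (dual_pred X).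
Proof.
split.
  apply/dual_predP; split; first by move=> a u v /=; rewrite scaler0 addr0.
  by move=> x; exact: cvg_cst.
move=> a f g /dual_predP[lf cf] /dual_predP[lg cg]; apply/dual_predP; split.
  move=> b u v; change ((a *: f + g) (b *: u + v)) with
    (a *: f (b *: u + v) + g (b *: u + v)).
  rewrite lf lg; change (a *: (b *: f u + f v) + (b *: g u + g v) =
    b *: (a *: f u + g u) + (a *: f v + g v)).
  by rewrite !scalerDr addrACA !scalerA [a * b]mulrC.
move=> x; exact: (cvgD (cvgZl_tmp (k := a) (cf x)) (cg x)).
Qed.

HB.instance Definition _ (R : realType) (X : normedModType R) :=
  GRing.isSubmodClosed.Build R (X -> R^o) (dual_pred X)
    (@dual_submod_closed R X).

Record dual (R : realType) (X : normedModType R) := Dual {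
  dual_val :> X -> R^o;
  dual_valP : dual_val \in dual_pred X }.

HB.instance Definition _ (R : realType) (X : normedModType R) :=
  [isSub for @dual_val R X].
HB.instance Definition _ (R : realType) (X : normedModType R) :=
  [Choice of dual X by <:].
HB.instance Definition _ (R : realType) (X : normedModType R) :=
  [SubChoice_isSubLmodule of dual X by <:].

Section dual_norm.
Context (R : realType) (X : normedModType R).
Implicit Types f g : dual X.

Lemma dual_linear f : linear f.
Proof. by have /dual_predP[] := dual_valP f. Qed.

Lemma dual_continuous f : continuous f.
Proof. by have /dual_predP[] := dual_valP f. Qed.

HB.instance Definition _ f :=
  GRing.isLinear.Build R X R^o *:%R (dual_val f) (dual_linear f).

Lemma dualD f g x : (f + g) x = f x + g x.
Proof. by []. Qed.

Lemma dualZ (a : R) f x : (a *: f) x = a * f x.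
Proof. by []. Qed.

Lemma dual_ext f g : f =1 g -> f = g.
Proof. by move=> fg; apply/val_inj/funext. Qed.

Definition dual_norm f : R := sup [set `|f x| | x in [set x : X | `|x| <= 1]].

Lemma dual_norm_has_sup f :
  has_sup [set `|f x| | x in [set x : X | `|x| <= 1]].
Proof.
split; first by exists `|f 0|, 0 => //=; rewrite normr0.
have /linear_bounded_continuous/linear_boundedP/pinfty_ex_gt0[r r0 fr] :
  continuous f := @dual_continuous f.
exists r => _ [x /= x1 <-]; apply: le_trans (fr x) _.
by rewrite ger_pMr.
Qed.

Lemma dual_norm_ubound f x : `|f x| <= dual_norm f * `|x|.
Proof.
have [->|x0] := eqVneq x 0; first by rewrite linear0 !normr0 mulr0.
have nx : 0 < `|x| by rewrite normr_gt0.
rewrite -ler_pdivrMr //.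
have -> : `|f x| / `|x| = `|f (`|x|^-1 *: x)|.
  by rewrite linearZ normrZ normfV normr_id mulrC.
apply: sup_ubound; first exact: (dual_norm_has_sup f).2.
exists (`|x|^-1 *: x) => //=.
by rewrite normrZ normfV normr_id mulVf ?gt_eqF.
Qed.

Lemma dual_norm_le f (M : R) :
  (forall x : X, `|x| <= 1 -> `|f x| <= M) -> dual_norm f <= M.
Proof.
move=> fM; apply: ge_sup; first exact: (dual_norm_has_sup f).1.
by move=> _ [x /= x1 <-]; exact: fM.
Qed.

Lemma dual_norm_ge0 f : 0 <= dual_norm f.
Proof.
apply: le_trans (normr_ge0 (f 0)) _.
apply: sup_ubound; first exact: (dual_norm_has_sup f).2.
by exists 0 => //=; rewrite normr0.
Qed.

Let dual_normD f g : dual_norm (f + g) <= dual_norm f + dual_norm g.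
Proof.
apply: dual_norm_le => x x1; rewrite dualD (le_trans (ler_normD _ _))// lerD//.
- by rewrite (le_trans (dual_norm_ubound f x))// ler_piMr// dual_norm_ge0.
- by rewrite (le_trans (dual_norm_ubound g x))// ler_piMr// dual_norm_ge0.
Qed.

Let dual_normZ_le (a : R) f : dual_norm (a *: f) <= `|a| * dual_norm f.
Proof.
apply: dual_norm_le => x x1; rewrite dualZ normrM ler_wpM2l//.
by rewrite (le_trans (dual_norm_ubound f x))// ler_piMr// dual_norm_ge0.
Qed.

Let dual_normZ (a : R) f : dual_norm (a *: f) = `|a| * dual_norm f.
Proof.
apply/eqP; rewrite eq_le dual_normZ_le /=.
have [->|a0] := eqVneq a 0.
  by rewrite normr0 mul0r dual_norm_ge0.
have na : 0 < `|a| by rewrite normr_gt0.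
rewrite -ler_pdivlMl // -normfV.
by rewrite -{1}[f](scalerK a0) dual_normZ_le.
Qed.

Let dual_norm0_eq0 f : dual_norm f = 0 -> f = 0.
Proof.
move=> f0; apply: dual_ext => x; apply/eqP; rewrite -normr_le0.
by rewrite (le_trans (dual_norm_ubound f x))// f0 mul0r.
Qed.

HB.instance Definition _ :=
  Lmodule_isNormed.Build R (dual X) dual_normD dual_normZ dual_norm0_eq0.

Lemma dual_normE f : `|f| = dual_norm f.
Proof. by []. Qed.

End dual_norm.

(* sigma(X, X'), the coarsest topology on X making all f : dual X continuous *)
Definition weak (R : realType) (X : normedModType R) :=
  sup_topology (fun f : dual X =>
    Topological.class (initial_topology (dual_val f))).

HB.instance Definition _ (R : realType) (X : normedModType R) :=
  Topological.on (weak X).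

Definition weakly_null (R : realType) (X : normedModType R)
    (u : nat -> X) : Prop :=
  (u : nat -> weak X) @ \oo --> ((0 : X) : weak X).

Lemma weakly_nullP (R : realType) (X : normedModType R) (u : nat -> X) :
  weakly_null u <-> forall f : dual X, f (u n) @[n --> \oo] --> (0 : R).
Proof.
split=> [u0 f|u0].
  have /cvg_sup/(_ f) uf := u0.
  rewrite -(linear0 (dual_val f)).
  apply: cvg_comp uf _.
  exact: (@initial_continuous X R^o (dual_val f)).
apply/cvg_sup => f A -[B [[C oC <-] /= Cf0 CA]].
have /u0 : nbhs (0 : R) C.
  by move: Cf0; rewrite linear0 => ?; exact: open_nbhs_nbhs.
by move=> /(_ f); exact: (@filterS _ (u @ \oo) _ _ _ CA).
Qed.

Definition relatively_weakly_compact (R : realType) (X : normedModType R)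
    (A : set X) : Prop :=
  compact (closure (A : set (weak X))).

(* The suprema below are taken in R.  They are finite since A is norm bounded,
   and sup set0 = 0, so the empty set satisfies each condition. *)
Definition DP_set (R : realType) (X : normedModType R) (A : set X) : Prop :=
  bounded_set A /\
  forall f : nat -> dual X, weakly_null f ->
    sup [set `|f n x| | x in A] @[n --> \oo] --> (0 : R).

Definition L_set (R : realType) (X : normedModType R)
    (A : set (dual X)) : Prop :=
  bounded_set A /\
  forall x : nat -> X, weakly_null x ->
    sup [set `|f (x n)| | f in A] @[n --> \oo] --> (0 : R).

Definition L_DP_set (R : realType) (X : normedModType R)
    (A : set (dual X)) : Prop :=
  bounded_set A /\
  forall x : nat -> X, weakly_null x -> DP_set (range x) ->
    sup [set `|f (x n)| | f in A] @[n --> \oo] --> (0 : R).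

Definition abs_convex_hull (R : realType) (V : normedModType R)
    (A : set V) : set V :=
  [set y | exists (n : nat) (l : 'I_n -> R) (x : 'I_n -> V),
    [/\ forall i, A (x i), \sum_i `|l i| <= 1 & y = \sum_i l i *: x i]].

Definition abs_closed_convex_hull (R : realType) (V : normedModType R)
    (A : set V) : set V :=
  closure (abs_convex_hull A).

(* Main.v *)
From HB Require Import structures.
Require Import Defs.
From mathcomp Require Import all_boot all_order all_algebra.
From mathcomp Require Import all_classical all_reals all_analysis.

Set Implicit Arguments.
Unset Strict Implicit.
Unset Printing Implicit Defensive.

Import Order.TTheory GRing.Theory Num.Def Num.Theory.
Import numFieldNormedType.Exports.

Local Open Scope classical_set_scope.
Local Open Scope ring_scope.

(** The statements on subsets and on absolutely closed convex hulls have the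
    same reason: any bound on the values [f x], [f] in [A], at a point [x]
    passes to the subset or to the hull, hence so do the norm bound of [A] and
    the suprema that must tend to zero ([L_DP_set_bipolar]).  An L-set is
    tested on more sequences than an L-Dunford-Pettis set.

    For a relatively weakly compact [A], the norm bound is the uniform
    boundedness principle, each evaluation being bounded on the weakly compact
    closure of [A].  If the suprema did not tend to zero along a weakly null
    Dunford-Pettis sequence [x], there would be [f_N] in [A] and indices
    [n_N >= N] with [f_N (x_(n_N))] bounded away from zero.  By the
    Eberlein-Smulian theorem, [f_N] minus some [h] is weakly null along a
    subsequence, so it tends to zero uniformly on the range of [x]; since also
    [h (x_n)] tends to zero, this is a contradiction.

    Eberlein-Smulian is proved following Whitley.  A weak cluster point [h] of
    a sequence [u] in a weakly compact set lies in the norm closed span of [u]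
    (so do differences of such points), and countably many functionals separate the points of that span.  A
    subsequence converging to [h] at each of these functionals therefore has
    [h] as its only weak cluster point, and converges weakly to [h] by
    compactness.  Both the membership in the closed span and the separating
    functionals come from the Hahn-Banach theorem, in the form: every sublinear
    functional dominates a linear functional that agrees with it at a given
    point. *)

(** * The Hahn-Banach theorem *)

(** Sublinear functionals.  Homogeneity is only required as an inequality;
    the reverse inequality follows ([sublinearZ]). *)
Definition sublinear (R : realType) (V : lmodType R) (p : V -> R) : Prop :=
  (forall x y, p (x + y) <= p x + p y) /\
  (forall a x, 0 <= a -> p (a *: x) <= a * p x).

Lemma le_addr_inf (R : realType) (A B : set R) (c : R) :
  A !=set0 -> B !=set0 -> (forall a b, A a -> B b -> c <= a + b) ->
  c <= inf A + inf B.
Proof.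
move=> A0 B0 cAB; rewrite -lerBlDr; apply: lb_le_inf => // a Aa.
rewrite lerBlDl -lerBlDr; apply: lb_le_inf => // b Bb.
by rewrite lerBlDl; exact: cAB.
Qed.

Lemma le_mulr_inf (R : realType) (A : set R) (k c : R) :
  A !=set0 -> 0 <= k -> (forall a, A a -> c <= k * a) -> c <= k * inf A.
Proof.
move=> A0; rewrite le_eqVlt => /predU1P[<- cA|k0 cA].
  by have [a /cA] := A0; rewrite !mul0r.
by rewrite -ler_pdivrMl//; apply: lb_le_inf => // a Aa; rewrite ler_pdivrMl ?cA.
Qed.

Section sublinear_theory.
Context (R : realType) (V : lmodType R).
Implicit Types (p q : V -> R) (x y v : V).

Lemma sublinear0 p : sublinear p -> p 0 = 0.
Proof.
move=> [pD pZ]; apply/eqP; rewrite eq_le; apply/andP; split.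
  by have := pZ 0 0 (lexx 0); rewrite scale0r mul0r.
by have := pD 0 0; rewrite addr0 lerDl.
Qed.

Lemma sublinear_geN p x : sublinear p -> - p (- x) <= p x.
Proof.
move=> sp; rewrite -subr_ge0 opprK -(sublinear0 sp) -(subrr x); exact: sp.1.
Qed.

Lemma sublinearZ p a x : sublinear p -> 0 <= a -> p (a *: x) = a * p x.
Proof.
move=> sp; rewrite le_eqVlt => /predU1P[<-|a0].
  by rewrite scale0r mul0r sublinear0.
apply/eqP; rewrite eq_le (sp.2 _ _ (ltW a0)) /= -ler_pdivlMl//.
rewrite -{1}(scalerK (lt0r_neq0 a0) x); apply: sp.2.
by rewrite invr_ge0 ltW.
Qed.

(** The infimum over [t >= 0] of [p (x + t v) - t p v].  This is a sublinear
    minorant of [p] whose value at [- v] is at most [- p v]. *)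
Definition tilt p v x : R :=
  inf [set p (x + t *: v) - t * p v | t in [set t | 0 <= t]].

Let tilt_nonempty p v x :
  [set p (x + t *: v) - t * p v | t in [set t | 0 <= t]] !=set0.
Proof. by exists (p (x + 0 *: v) - 0 * p v), 0 => /=. Qed.

Lemma tilt_le p v x t : sublinear p -> 0 <= t ->
  tilt p v x <= p (x + t *: v) - t * p v.
Proof.
move=> sp t0; apply: ge_inf; last by exists t.
exists (- p (- x)) => _ [s /= s0 <-].
rewrite lerBrDr -(sublinearZ v sp s0) addrC lerBlDr.
apply: le_trans (sp.1 _ _).
by rewrite addrAC subrr add0r.
Qed.

Lemma sublinear_tilt p v : sublinear p -> sublinear (tilt p v).
Proof.
move=> sp; split=> [x y|a x a0].
  apply: le_addr_inf => // _ _ [s /= s0 <-] [t /= t0 <-].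
  apply: le_trans (tilt_le v _ sp (addr_ge0 s0 t0)) _.
  rewrite mulrDl opprD addrACA lerD2r scalerDl addrACA; exact: sp.1.
apply: le_mulr_inf => // _ [t /= t0 <-].
apply: le_trans (tilt_le v _ sp (mulr_ge0 a0 t0)) _.
rewrite mulrBr mulrA lerD2r -scalerA -scalerDr; exact: sp.2.
Qed.

Lemma tilt_le_self p v x : sublinear p -> tilt p v x <= p x.
Proof.
by move=> sp; have := tilt_le v x sp (lexx 0); rewrite scale0r addr0 mul0r subr0.
Qed.

Lemma tiltN_le p v : sublinear p -> tilt p v (- v) <= - p v.
Proof.
move=> sp; have := tilt_le v (- v) sp ler01.
by rewrite scale1r addNr mul1r (sublinear0 sp) add0r.
Qed.

(** Zorn's lemma: the pointwise infimum of a chain of sublinear functionals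
    below [p] is sublinear, the bound [- p (- x)] keeping it finite. *)
Lemma minimal_sublinear p : sublinear p ->
  exists m, [/\ sublinear m, forall x, m x <= p x &
    forall q, sublinear q -> (forall x, q x <= m x) -> forall x, m x <= q x].
Proof.
move=> sp.
pose T := {q : V -> R | sublinear q /\ forall x, q x <= p x}.
pose p' : T := exist _ p (conj sp (fun=> lexx _)).
(* Zorn's lemma yields maximal elements, so the pointwise order is reversed. *)
pose below (q r : T) := `[< forall x, sval r x <= sval q x >].
have [||C Ctot|[m [sm mp]] mmin] := @ZL_preorder T p' below.
- by move=> q; apply/asboolP.
- move=> q r s /asboolP qr /asboolP rs; apply/asboolP => x.
  exact: le_trans (rs x) (qr x).
- have [[q0 Cq0]|C0] := pselect (C !=set0); last first.
    by exists p' => q Cq; exfalso; apply: C0; exists q.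
  pose S x := [set sval q x | q in C].
  have S0 x : S x !=set0 by exists (sval q0 x), q0.
  have inf_le (q : T) x : C q -> inf (S x) <= sval q x.
    move=> Cq; apply: ge_inf; last by exists q.
    exists (- p (- x)) => _ [r Cr <-]; case: (svalP r) => sr rp.
    by apply: le_trans (sublinear_geN x sr); rewrite lerN2.
  have si : sublinear (fun x => inf (S x)).
    split=> [x y|a x a0].
      apply: le_addr_inf => // _ _ [q Cq <-] [r Cr <-].
      have [/asboolP qr|/asboolP rq] := Ctot q r Cq Cr.
        apply: le_trans (inf_le r _ Cr) _.
        by apply: le_trans ((svalP r).1.1 x y) _; rewrite lerD2r.
      apply: le_trans (inf_le q _ Cq) _.
      by apply: le_trans ((svalP q).1.1 x y) _; rewrite lerD2l.
    apply: le_mulr_inf => // _ [q Cq <-].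
    apply: le_trans (inf_le q _ Cq) _; exact: (svalP q).1.2.
  have ip x : inf (S x) <= p x.
    exact: le_trans (inf_le q0 x Cq0) ((svalP q0).2 x).
  exists (exist _ (fun x => inf (S x)) (conj si ip)) => q Cq.
  by apply/asboolP => x; exact: inf_le.
- exists m; split=> // q sq qm.
  have qp x : q x <= p x by exact: le_trans (qm x) (mp x).
  have /asboolP := mmin (exist _ q (conj sq qp)) (asboolT qm).
  exact.
Qed.

(** A minimal sublinear functional [m] equals each of its tilts, which makes
    it odd, hence linear. *)
Theorem Hahn_Banach p v : sublinear p ->
  exists f : V -> R^o, [/\ linear f, forall x, f x <= p x & f v = p v].
Proof.
move=> sp.
have [m [sm mt mmin]] := minimal_sublinear (sublinear_tilt v sp).
have mN x : m (- x) = - m x.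
  apply/eqP; rewrite eq_le; apply/andP; split; last first.
    by have := sublinear_geN (- x) sm; rewrite opprK.
  apply: le_trans (tiltN_le x sm).
  by apply: mmin => [|y]; [exact: sublinear_tilt | exact: tilt_le_self].
have mD x y : m (x + y) = m x + m y.
  apply/eqP; rewrite eq_le sm.1 /= -lerN2 -mN !opprD -!mN; exact: sm.1.
have mZ a x : m (a *: x) = a * m x.
  have [a0|/ltW a0] := leP 0 a; first exact: sublinearZ.
  by rewrite -[a]opprK scaleNr mN (sublinearZ _ sm) ?oppr_ge0// !mulNr.
exists m; split=> [a x y|x|].
- by rewrite mD mZ.
- apply: le_trans (mt x) _; exact: tilt_le_self.
- apply/eqP; rewrite eq_le (le_trans (mt v) (tilt_le_self v v sp)) /=.
  by rewrite -lerN2 -mN (le_trans (mt _))// tiltN_le.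
Qed.

End sublinear_theory.

(** * Continuous functionals and closed subspaces *)

Section dual_functionals.
Context (R : realType) (V : normedModType R).

Lemma dual_of_bounded_linear (f : V -> R^o) (c : R) :
  linear f -> (forall x, `|f x| <= c * `|x|) -> exists g : dual V, g =1 f.
Proof.
move=> lf fc.
pose F : {linear V -> R^o} := HB.pack f (GRing.isLinear.Build _ _ _ _ _ lf).
have cf : continuous F.
  apply/linear_bounded_continuous/linear_boundedP.
  exists c; split=> [|r /ltW cr x]; first exact: num_real.
  by apply: le_trans (fc x) _; rewrite ler_wpM2r.
have df : f \in dual_pred V by apply/dual_predP.
by exists (Dual df).
Qed.

Lemma Hahn_Banach_dual (p : V -> R) (v : V) :
  sublinear p -> (forall x, p x <= `|x|) ->
  exists f : dual V, [/\ forall x, f x <= p x, forall x, `|f x| <= `|x| &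
    f v = p v].
Proof.
move=> sp pn; have [f [lf fp fv]] := Hahn_Banach v sp.
have fN x : - f x = f (- x).
  have f0 : f 0 = 0.
    by have := lf (-1) 0 0; rewrite scaler0 addr0 scaleN1r addNr.
  by have := lf (-1) x 0; rewrite !addr0 f0 addr0 !scaleN1r => ->.
have fn x : `|f x| <= `|x|.
  rewrite ler_norml lerNl fN -{1}normrN.
  by rewrite !(le_trans (fp _))// ?pn.
have [|g gf] := @dual_of_bounded_linear f 1 lf.
  by move=> x; rewrite mul1r.
by exists g; split=> [x|x|]; rewrite gf.
Qed.

Lemma norming_functional (v : V) :
  exists f : dual V, (forall x, `|f x| <= `|x|) /\ f v = `|v|.
Proof.
have sn : sublinear (fun x : V => `|x|).
  by split=> [x y|a x a0]; [exact: ler_normD | rewrite normrZ ger0_norm].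
by have [f [_ fn fv]] := Hahn_Banach_dual v sn (fun=> lexx _); exists f.
Qed.

(** The distance to [Y] is a sublinear functional below the norm.  A linear
    functional that it dominates vanishes on [Y]; taking one that equals it at
    [v] shows that [v] is at distance zero from [Y]. *)
Lemma closure_annihilator (Y : set V) (v : V) :
  Y 0 -> (forall a x y, Y x -> Y y -> Y (a *: x + y)) ->
  (forall f : dual V, (forall y, Y y -> f y = 0) -> f v = 0) -> closure Y v.
Proof.
move=> Y0 YL annY.
pose dY x : R := inf [set `|x - y| | y in Y].
have dY_le x y : Y y -> dY x <= `|x - y|.
  by move=> Yy; apply: ge_inf; [exists 0 => _ [z _ <-] | exists y].
have ne x : [set `|x - y| | y in Y] !=set0 by exists `|x - 0|, 0.
have sd : sublinear dY.
  split=> [x y|a x a0].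
    apply: le_addr_inf => // _ _ [y1 Y1 <-] [y2 Y2 <-].
    have Y12 : Y (y1 + y2) by rewrite -[y1]scale1r; exact: YL.
    by rewrite (le_trans (dY_le _ _ Y12))// opprD addrACA ler_normD.
  apply: le_mulr_inf => // _ [y Yy <-].
  have Yay : Y (a *: y) by rewrite -[_ *: _]addr0; exact: YL.
  by rewrite (le_trans (dY_le _ _ Yay))// -scalerBr normrZ ger0_norm.
have [x|f [fd _ fv]] := Hahn_Banach_dual v sd.
  by rewrite -[X in _ <= `|X|]subr0; exact: dY_le.
have dv0 : dY v = 0.
  rewrite -fv; apply: annY => y Yy.
  have dY0 z : Y z -> dY z <= 0 by move=> /(dY_le z); rewrite subrr normr0.
  apply/eqP; rewrite eq_le (le_trans (fd y) (dY0 _ Yy)) /=.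
  rewrite -oppr_le0 -linearN (le_trans (fd _))// dY0//.
  by rewrite -scaleN1r -[_ *: _]addr0; exact: YL.
move=> B /nbhs_ballP[e /= e0 eB].
have /inf_lt : dY v < e by rewrite dv0.
case/(_ (ne v)) => _ [y Yy <-] vye; exists y; split=> //.
by apply: eB; rewrite -ball_normE.
Qed.

End dual_functionals.

(** * Countable separating families on separable subspaces *)

Section separating.
Context (R : realType) (V : normedModType R) (u : nat -> V).

(** The linear span of the sequence [u].  Coefficients beyond [n] are
    irrelevant. *)
Definition seq_span : set V :=
  [set y | exists (n : nat) (c : nat -> R), y = \sum_(i < n) c i *: u i].

Lemma seq_span_gen n : seq_span (u n).
Proof.
exists n.+1, (fun i => (i == n)%:R).
rewrite big_ord_recr /= eqxx scale1r big1 ?add0r// => i _.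
by rewrite ltn_eqF ?scale0r.
Qed.

Lemma seq_span0 : seq_span 0.
Proof. by exists 0%N, (fun=> 0); rewrite big_ord0. Qed.

Lemma seq_spanL a x y : seq_span x -> seq_span y -> seq_span (a *: x + y).
Proof.
have pad n (c : nat -> R) m : (n <= m)%N -> \sum_(i < n) c i *: u i =
    \sum_(i < m) (if (i < n)%N then c i else 0) *: u i.
  move=> nm; rewrite (big_ord_widen _ (fun i => c i *: u i) nm) big_mkcond /=.
  by apply: eq_bigr => i _; case: ifP; rewrite ?scale0r.
move=> [n [c ->]] [m [d ->]].
rewrite (pad _ c _ (leq_maxl n m)) (pad _ d _ (leq_maxr n m)).
eexists _, (fun i => a * (if (i < n)%N then c i else 0) +
  (if (i < m)%N then d i else 0)).
rewrite scaler_sumr -big_split /=; apply: eq_bigr => i _.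
by rewrite scalerDl scalerA.
Qed.

(** The rational combination of the first terms of [u] whose coefficients
    are listed in [s]. *)
Definition rat_comb (s : seq rat) : V := \sum_(i < size s) ratr s`_i *: u i.

Lemma rat_comb_dense (y : V) (e : R) : closure seq_span y -> 0 < e ->
  exists s, `|y - rat_comb s| < e.
Proof.
move=> cy e0; have e20 : 0 < e / 2 by rewrite divr_gt0.
have [_ [[n [c ->]]]] := cy _ (nbhsx_ballx y _ e20).
rewrite -ball_normE /= => yc.
(* This tolerance on the i-th coefficient moves the sum by less than e / 2;
   the added 1 covers the case where [u i] is zero. *)
pose d i := e / 2 / n.+1%:R / (`|u i| + 1).
have d0 i : 0 < d i by rewrite !divr_gt0// ltr_wpDl.
have /choice[q qP] i : exists q : rat, `|c i - ratr q| < d i.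
  have [|q] := @rat_in_itvoo R (c i - d i) (c i + d i).
    by rewrite ltrBlDr -addrA ltrDl addr_gt0.
  by rewrite in_itv /= => qi; exists q; rewrite distrC ltr_distl.
exists (mkseq q n).
rewrite (splitr e) (le_lt_trans (ler_distD (\sum_(i < n) c i *: u i) _ _))//.
rewrite ltrD//.
rewrite /rat_comb size_mkseq -sumrB (le_lt_trans (ler_norm_sum _ _ _))//.
apply: (@le_lt_trans _ _ (\sum_(i < n) e / 2 / n.+1%:R)).
  apply: ler_sum => i _; rewrite nth_mkseq// -scalerBl normrZ.
  have ui : 0 < `|u i| + 1 by rewrite ltr_wpDl.
  rewrite -[leRHS](divfK (lt0r_neq0 ui)) ler_pM//; first exact/ltW/qP.
  by rewrite lerDl.
rewrite sumr_const card_ord -[ltLHS]mulr_natr -[ltLHS]mulrA gtr_pMr//.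
by rewrite ltr_pdivrMl// mulr1 ltr_nat.
Qed.

(** Functionals norming the countably many rational combinations of the
    [u n] separate the points of the closed span of [u]. *)
Lemma separating_sequence : exists D : nat -> dual V,
  forall y, closure seq_span y -> (forall n, D n y = 0) -> y = 0.
Proof.
have /choice[F FP] s := norming_functional (rat_comb s).
(* The functionals [F s] are listed along the enumeration of [seq rat]; codes
   of no list give the zero functional. *)
exists (fun n => oapp F 0 (unpickle n)) => y cy Dy.
have Fy s : F s y = 0 by have := Dy (pickle s); rewrite pickleK.
apply/eqP; rewrite -normr_le0; apply/ler_addgt0Pr => e e0; rewrite add0r.
have e20 : 0 < e / 2 by rewrite divr_gt0.
have [s ys] := rat_comb_dense cy e20.
have [Fn Fs] := FP s.
rewrite -(subrK (rat_comb s) y) (splitr e) (le_trans (ler_normD _ _))//.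
apply: lerD; first exact: ltW.
rewrite -Fs -[F s _]subr0 -(Fy s) -linearB /=.
rewrite (le_trans (ler_norm _))// (le_trans (Fn _))// distrC.
exact: ltW.
Qed.

End separating.

(** * The weak topology and sequential compactness *)

Section weak_topology.
Context (R : realType) (V : normedModType R).

Lemma weak_continuous (f : dual V) :
  continuous (dual_val f : weak V -> R^o).
Proof.
move=> x; have /cvg_sup/(_ f) xf : nbhs (x : weak V) --> (x : weak V) by [].
apply: cvg_comp xf _; exact: (@initial_continuous V R^o (dual_val f)).
Qed.

Lemma weakly_compact_bounded (K : set V) (f : dual V) :
  compact (K : set (weak V)) -> exists M, forall x, K x -> `|f x| <= M.
Proof.
move=> cK.
have /compact_bounded/pinfty_ex_gt0[M _ fM] : compact [set (f x : R^o) | x in K].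
  apply: (@continuous_compact (weak V) R^o) cK.
  exact/continuous_subspaceT/weak_continuous.
by exists M => x Kx; apply: fM; exists x.
Qed.

Lemma weak_cluster_dual (u : nat -> V) (y : V) (f : dual V) (l : R) :
  cluster ((u : nat -> weak V) @ \oo) y -> f (u n) @[n --> \oo] --> l ->
  f y = l.
Proof.
move=> uy /cvgrPdist_lt ful; apply/eqP; rewrite -subr_eq0 -normr_le0.
apply/ler_addgt0Pr => e e0; rewrite add0r.
have e20 : 0 < e / 2 by rewrite divr_gt0.
have fy : nbhs (y : weak V) [set z | `|f y - f z| < e / 2].
  have /cvgrPdist_lt := @weak_continuous f y; exact.
have ul : ((u : nat -> weak V) @ \oo) [set z | `|l - f z| < e / 2].
  exact: ful.
have [z [/= lz yz]] := uy _ _ ul fy.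
rewrite (splitr e) (le_trans (ler_distD (f z) _ _))// lerD// ltW//.
by rewrite distrC.
Qed.

(** Differences of weak cluster points of [u] lie in its closed span: a
    functional that vanishes on [u] vanishes at each cluster point. *)
Lemma weak_cluster_spanB (u : nat -> V) (y z : V) :
  cluster ((u : nat -> weak V) @ \oo) y ->
  cluster ((u : nat -> weak V) @ \oo) z -> closure (seq_span u) (y - z).
Proof.
move=> uy uz; apply: closure_annihilator; first exact: seq_span0.
  exact: seq_spanL.
move=> f f0; have fu0 : f (u n) @[n --> \oo] --> (0 : R).
  have -> : (fun n => f (u n)) = cst 0.
    by apply/funext => n; exact/f0/seq_span_gen.
  exact: cvg_cst.
by rewrite linearB /= (weak_cluster_dual uy fu0) (weak_cluster_dual uz fu0)
  subr0.
Qed.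

End weak_topology.

Lemma compact_unique_cluster_cvg (T : topologicalType) (K : set T)
    (F : set_system T) (x : T) : ProperFilter F -> compact K -> F K ->
  (forall y, cluster F y -> y = x) -> F --> x.
Proof.
move=> PF cK FK Fx U xU; apply: contrapT => FU.
(* Otherwise [F] restricted to the complement of [U] is proper; its cluster
   point in [K] must be [x], although [U] is a neighborhood of [x]. *)
have PG : ProperFilter (within (~` U) F).
  split; last exact: within_filter.
  by rewrite /within /= => FU0; apply: FU; apply: filterS FU0 => z /contrapT.
have [|y [_ Gy]] := cK _ PG; first by apply: filterS FK => z.
have yx : y = x by apply: Fx => A B FA; apply: Gy; apply: filterS FA => z.
rewrite yx in Gy.
have [|z [zU Uz]] := Gy (~` U) U _ xU; last exact: zU.
exact: (@filterE _ F).
Qed.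

(** The sequential half of the Eberlein-Smulian theorem.  A subsequence that
    converges at each functional of a separating sequence has only one weak
    cluster point.  The extraction [k] is not required to be increasing:
    [n <= k n] already makes it tend to infinity. *)
Theorem Eberlein_Smulian (R : realType) (V : normedModType R) (A : set V)
    (u : nat -> V) : relatively_weakly_compact A -> (forall n, A (u n)) ->
  exists (k : nat -> nat) (h : V), (forall n, (n <= k n)%N) /\
    weakly_null (fun n => u (k n) - h).
Proof.
move=> cA Au.
have cluA v : (forall n, A (v n)) ->
    ((v : nat -> weak V) @ \oo) (closure (A : set (weak V))).
  by move=> Av; exists 0%N => // n _; exact/subset_closure/Av.
have [h [_ uh]] := cA _ _ (cluA u Au).
have [D Dsep] := separating_sequence u.
(* The first [j.+1] functionals of [D] define a weak neighborhood of the
   cluster point [h], which [u] meets at some index [k >= j]. *)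
have /choice[k kP] j : exists k, (j <= k)%N /\
    forall i : 'I_j.+1, `|D i h - D i (u k)| < j.+1%:R^-1.
  have j0 : 0 < j.+1%:R^-1 :> R by rewrite invr_gt0.
  have Dh : nbhs (h : weak V)
      [set z | forall i : 'I_j.+1, `|D i h - D i z| < j.+1%:R^-1].
    apply: (@filter_forall _ _ _ (nbhs (h : weak V))) => i.
    have /cvgrPdist_lt := @weak_continuous _ _ (D i) h; exact.
  have uj : ((u : nat -> weak V) @ \oo) (u @` [set k | (j <= k)%N]).
    by exists j => // k /= jk; exists k.
  by have [_ [[k jk <-] kh]] := uh _ _ uj Dh; exists k.
exists k, h; split=> [n|]; first by case: (kP n).
have kcvg : k @ \oo --> \oo.
  move=> B [N _ NB]; exists N => // n /= Nn; apply: NB => /=.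
  by rewrite (leq_trans Nn)//; case: (kP n).
pose v : nat -> V := u \o k.
have vD i : D i (v n) @[n --> \oo] --> D i h.
  apply/cvgrPdist_lt => e e0; near=> n.
  have ni : (i < n.+1)%N by rewrite ltnS; near: n; exact: nbhs_infty_ge.
  apply: lt_trans ((kP n).2 (Ordinal ni)) _.
  by near: n; exact: near_infty_natSinv_lt (PosNum e0).
have vh : (v : nat -> weak V) @ \oo --> (h : weak V).
  apply: compact_unique_cluster_cvg cA _ _ => [|y vy].
    by apply: cluA => n; exact: Au.
  have uy : cluster ((u : nat -> weak V) @ \oo) y.
    by move=> B C uB; apply: vy; exact: (kcvg (u @^-1` B)).
  apply/eqP; rewrite -subr_eq0; apply/eqP/Dsep.
    exact: weak_cluster_spanB.
  by move=> i; rewrite linearB /= (weak_cluster_dual vy (vD i)) subrr.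
apply/weakly_nullP => f; rewrite -(subrr (f h)).
under eq_fun do rewrite linearB /=.
apply: cvgB; last exact: cvg_cst.
exact: (cvg_comp _ _ vh (@weak_continuous _ _ f h)).
Unshelve. all: by end_near. Qed.

(** * L-Dunford-Pettis sets *)

Section sup_norm.
Context (R : realType) (T : Type) (A : set T) (g : T -> R).

(** No boundedness is needed, as [sup] is [0] on sets without a supremum. *)
Lemma sup_norm_ge0 : 0 <= sup [set `|g t| | t in A].
Proof.
have [hs|nhs] := pselect (has_sup [set `|g t| | t in A]); last first.
  by rewrite sup_out.
have [[_ [t At _]] ub] := hs.
by apply: le_trans (normr_ge0 (g t)) _; apply: sup_ubound => //; exists t.
Qed.

Lemma sup_norm_le (M : R) : 0 <= M -> (forall t, A t -> `|g t| <= M) ->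
  sup [set `|g t| | t in A] <= M.
Proof.
move=> M0 gM; have [[t At]|A0] := pselect (A !=set0).
  by apply: ge_sup; [exists `|g t|, t | move=> _ [s As <-]; exact: gM].
rewrite (_ : [set _ | _ in _] = set0) ?sup0//.
by apply/seteqP; split=> // r [t At _]; apply: A0; exists t.
Qed.

Lemma le_sup_norm (M : R) t : (forall t, A t -> `|g t| <= M) -> A t ->
  `|g t| <= sup [set `|g t| | t in A].
Proof.
move=> gM At; apply: sup_ubound; last by exists t.
by exists M => _ [s As <-]; exact: gM.
Qed.

End sup_norm.

Lemma bounded_set_le (R : realType) (V : normedModType R) (A : set V) :
  bounded_set A <-> exists M, 0 <= M /\ forall x, A x -> `|x| <= M.
Proof.
split=> [/pinfty_ex_gt0[M M0 AM]|[M [_ AM]]]; first by exists M; rewrite ltW.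
exists M; split=> [|r /ltW Mr x Ax]; first exact: num_real.
exact: le_trans (AM x Ax) Mr.
Qed.

Lemma dual_le (R : realType) (X : normedModType R) (f : dual X) (M : R) x :
  `|f| <= M -> `|f x| <= M * `|x|.
Proof.
move=> fM; apply: le_trans (dual_norm_ubound f x) _.
by rewrite ler_wpM2r// -dual_normE.
Qed.

(** Evaluation at a point, as an element of the bidual. *)
Lemma evaluation_bidual (R : realType) (X : normedModType R) (x : X) :
  exists J : dual (dual X), forall f, J f = f x.
Proof.
apply: (@dual_of_bounded_linear _ _ (fun f : dual X => f x : R^o) `|x|) => //.
by move=> f; rewrite mulrC; exact: dual_norm_ubound.
Qed.

Section L_DP.
Context (R : realType) (X : normedModType R).
Implicit Types A B : set (dual X).

(** The hypothesis says that [B] lies in the absolute bipolar of [A] with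
    respect to the duality between the space and its dual. *)
Lemma L_DP_set_bipolar A B : L_DP_set A ->
  (forall x M, 0 <= M -> (forall f, A f -> `|f x| <= M) ->
    forall f, B f -> `|f x| <= M) -> L_DP_set B.
Proof.
move=> [/bounded_set_le[M [M0 AM]] DPA] AB.
have Ax x f : A f -> `|f x| <= M * `|x| by move=> /AM; exact: dual_le.
split.
  apply/bounded_set_le; exists M; split=> // f Bf; rewrite dual_normE.
  apply: dual_norm_le => x x1; apply: AB (Bf) => // g Ag.
  by rewrite (le_trans (Ax x g Ag))// ler_piMr.
move=> x wx DPx.
apply: (squeeze_cvgr _ (cvg_cst 0) (DPA x wx DPx)); apply: nearW => n.
rewrite sup_norm_ge0 /= sup_norm_le ?sup_norm_ge0// => f Bf.
apply: AB (Bf); first exact: sup_norm_ge0.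
by move=> g Ag; apply: le_sup_norm Ag => g' /Ax; exact.
Qed.

Lemma abs_closed_convex_hull_le A (x : X) (M : R) f : 0 <= M ->
  (forall f, A f -> `|f x| <= M) -> abs_closed_convex_hull A f -> `|f x| <= M.
Proof.
move=> M0 AM cf; apply/ler_addgt0Pr => e e0.
have d0 : 0 < e / (`|x| + 1) by rewrite divr_gt0// ltr_wpDl.
have [_ [[n [l [a [Aa l1 ->]]]]]] := cf _ (nbhsx_ballx f _ d0).
set g := \sum_i _; rewrite -ball_normE /= => fg.
have gx : `|g x| <= M.
  have [J Jx] := evaluation_bidual x.
  have -> : g x = \sum_i l i * a i x.
    by rewrite -Jx linear_sum; apply: eq_bigr => i _; rewrite linearZ /= Jx.
  apply: le_trans (ler_norm_sum _ _ _) _.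
  apply: (@le_trans _ _ (\sum_i `|l i| * M)).
    by apply: ler_sum => i _; rewrite normrM ler_wpM2l// AM.
  by rewrite -mulr_suml ler_piMl.
have -> : f x = g x + (f - g) x by rewrite -dualD addrC subrK.
rewrite (le_trans (ler_normD _ _))// lerD//.
apply: le_trans (dual_le x (ltW fg)) _.
have x1 : 0 < `|x| + 1 by rewrite ltr_wpDl.
by rewrite -mulrA ger_pMr// ler_pdivrMl// mulr1 lerDl.
Qed.

Lemma L_set_L_DP_set A : L_set A -> L_DP_set A.
Proof. by move=> [bA LA]; split=> // x wx _; exact: LA. Qed.

End L_DP.

Lemma relatively_weakly_compact_bounded (R : realType)
    (X : completeNormedModType R) (A : set (dual X)) :
  relatively_weakly_compact A -> bounded_set A.
Proof.
move=> cA.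
have bl (f : X -> R^o) : [set dual_val f | f in A] f ->
    bounded_fun_norm f /\ linear f.
  move=> [g _ <-]; split; last exact: dual_linear.
  move=> r; exists (`|g| * r) => x xr.
  by apply: le_trans (dual_le x (lexx _)) _; rewrite ler_wpM2l.
have pb : pointwise_bounded [set (dual_val f : X -> R^o) | f in A].
  move=> x; have [J Jx] := evaluation_bidual x.
  have [M KM] := weakly_compact_bounded J cA.
  by exists M => _ [f Af <-]; rewrite -Jx; exact/KM/subset_closure.
have [M AM] := Banach_Steinhauss bl pb 1.
apply/bounded_set_le; exists `|M|; split=> // f Af.
rewrite dual_normE; apply: dual_norm_le => x x1.
by rewrite (le_trans _ (ler_norm M))//; apply: AM => //; exists f.
Qed.

(** If the suprema do not tend to [0], there are [e > 0], [f_N] in [A] and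
    indices [n_N >= N] with [|f_N (x_(n_N))| >= e / 2].  Along a subsequence
    [f_N - h] is weakly null, so it tends to [0] uniformly on the
    Dunford-Pettis set of the [x_n], while [h (x_n)] tends to [0]. *)
Lemma relatively_weakly_compact_L_DP_set (R : realType)
    (X : completeNormedModType R) (A : set (dual X)) :
  relatively_weakly_compact A -> L_DP_set A.
Proof.
move=> cA; split; first exact: relatively_weakly_compact_bounded.
move=> x wx [/bounded_set_le[C [C0 xC]] DPx].
apply/cvgr0Pnorm_lt => e e0; apply: contrapT => ncvg.
have e20 : 0 < e / 2 by rewrite divr_gt0.
have e40 : 0 < e / 2 / 2 by rewrite divr_gt0.
have /choice[nf nfP] N : exists nf : nat * dual X,
    [/\ (N <= nf.1)%N, A nf.2 & e / 2 <= `|nf.2 (x nf.1)|].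
  apply: contrapT => nex; apply: ncvg; exists N => // n /= Nn.
  rewrite ger0_norm ?sup_norm_ge0//.
  apply: (@le_lt_trans _ _ (e / 2)); last by rewrite gtr_pMr// invf_lt1// ltr1n.
  apply: sup_norm_le => [|f Af]; first exact: ltW.
  by rewrite leNgt; apply/negP => /ltW fx; apply: nex; exists (n, f).
have [k [h [kn wk]]] := Eberlein_Smulian (u := fun N => (nf N).2) cA
  (fun N => let: And3 _ AN _ := nfP N in AN).
have /cvgr0Pnorm_lt/(_ _ e40) gsmall := DPx _ wk.
have /cvgr0Pnorm_lt/(_ _ e40)[N _ hsmall] := (weakly_nullP x).1 wx h.
have [N' _ {}gsmall] := gsmall.
pose j := maxn N N'.
have /gsmall : (N' <= j)%N by exact: leq_maxr.
have jk : (N <= (nf (k j)).1)%N.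
  have [kj _ _] := nfP (k j).
  by rewrite (leq_trans (leq_maxl N N'))// (leq_trans (kn j))// (leq_trans kj).
have /= := hsmall _ jk.
have [_ _] := nfP (k j); set f := (nf (k j)).2; set y := x _.
move=> fy hy; rewrite ger0_norm ?sup_norm_ge0// => gj.
have gy : `|(f - h) y| <= sup [set `|(f - h) z| | z in range x].
  apply: (@le_sup_norm _ _ _ _ (`|f - h| * C)); last by exists (nf (k j)).1.
  move=> z xz; apply: le_trans (dual_le z (lexx _)) _.
  by rewrite ler_wpM2l// xC.
have : `|f y| < e / 2.
  have -> : f y = (f - h) y + h y by rewrite -dualD subrK.
  rewrite (le_lt_trans (ler_normD _ _))// [ltRHS]splitr ltrD//.
  exact: le_lt_trans gy gj.
by rewrite ltNge fy.
Qed.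

(** * Stability properties of L-Dunford-Pettis sets *)

Theorem proposition2p3 (R : realType) (X : completeNormedModType R) :
  [/\ forall A B : set (dual X), B `<=` A -> L_DP_set A -> L_DP_set B,
      forall A : set (dual X), L_set A -> L_DP_set A,
      forall A : set (dual X), relatively_weakly_compact A -> L_DP_set A &
      forall A : set (dual X), L_DP_set A -> L_DP_set (abs_closed_convex_hull A)].
Proof.
split.
- move=> A B BA DPA; apply: (L_DP_set_bipolar DPA) => x M _ AM f Bf.
  exact/AM/BA.
- exact: L_set_L_DP_set.
- exact: relatively_weakly_compact_L_DP_set.
- move=> A DPA; apply: (L_DP_set_bipolar DPA) => x M M0 AM f.
  exact: abs_closed_convex_hull_le.
Qed.
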